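(* There is no non-trivial class of idempotent semifields that is finitely based. That is, if $\mathsf{K}$ is a class of idempotent semifields (algebras in the signature $\{\vee,\cdot,\mathrm{e}\}$) such that at least one member of $\mathsf{K}$ has more than one element, then the equational theory $\mathrm{Eq}(\mathsf{K})$ has no finite basis.
   Context: An idempotent semiring is an algebraic structure $\langle S,\vee,\cdot,\mathrm{e}\rangle$ such that $\langle S,\cdot,\mathrm{e}\rangle$ is a monoid, $\langle S,\vee\rangle$ is a semilattice (an idempotent commutative semigroup), and $a(b\vee c)d=abd\vee acd$ for all $a,b,c,d\in S$. It is called an idempotent semifield if $\langle S,\cdot,\mathrm{e}\rangle$ is the monoid reduct of a group (i.e., every element is invertible). The signature is $\{\vee,\cdot,\mathrm{e}\}$ (no inverse operation and no meet). For a signature $\mathcal{L}$, an $\mathcal{L}$-algebra is a non-empty set with an operation for each symbol of $\mathcal{L}$. $\mathcal{L}$-terms are built from a countably infinite set of variables; an $\mathcal{L}$-equation $s\approx t$ is an ordered pair of $\mathcal{L}$-terms, and it is satisfied by an $\mathcal{L}$-algebra $\mathbf{A}$ if $\varphi(s)=\varphi(t)$ for every homomorphism $\varphi$ from the $\mathcal{L}$-term algebra to $\mathbf{A}$. For a class $\mathsf{K}$ of $\mathcal{L}$-algebras, $\mathrm{Eq}(\mathsf{K})$ is the set of all $\mathcal{L}$-equations satisfied by all members of $\mathsf{K}$. A basis for $\mathrm{Eq}(\mathsf{K})$ is a set $\Sigma\subseteq\mathrm{Eq}(\mathsf{K})$ such that every $\mathcal{L}$-algebra satisfying all equations in $\Sigma$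 satisfies all equations in $\mathrm{Eq}(\mathsf{K})$. The class $\mathsf{K}$ is finitely based if $\mathrm{Eq}(\mathsf{K})$ has a finite basis, and non-trivial if at least one of its members has more than one element. *)

(* Defs.v *)
From mathcomp Require Import all_boot.
From mathcomp Require Import classical_sets cardinality.
Set Implicit Arguments.
Unset Strict Implicit.
Unset Printing Implicit Defensive.

Local Open Scope classical_set_scope.

(* Algebras in the signature {\/, ., e}.  No law is imposed; the carrier is
   nonempty because it contains [e]. *)
Record algebra := Algebra {
  carrier :> Type;
  join : carrier -> carrier -> carrier;
  mul : carrier -> carrier -> carrier;
  e : carrier }.
Arguments join {a} _ _.
Arguments mul {a} _ _.
Arguments e {a}.

Definition homomorphism (A B : algebra) (f : A -> B) : Prop :=
  [/\ forall x y, f (join x y) = join (f x) (f y),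
      forall x y, f (mul x y) = mul (f x) (f y)
    & f e = e].

Inductive term :=
| Var of nat
| Join of term & term
| Mul of term & term
| E.

Definition term_algebra : algebra := Algebra Join Mul E.

Definition equation := (term * term)%type.

Definition satisfies (A : algebra) (eqn : equation) : Prop :=
  forall f : term_algebra -> A, homomorphism f -> f eqn.1 = f eqn.2.

Definition Eq (K : set algebra) : set equation :=
  [set eqn | forall A, K A -> satisfies A eqn].

Definition is_basis (Sigma : set equation) (K : set algebra) : Prop :=
  Sigma `<=` Eq K /\
  forall A : algebra, (forall eqn, Sigma eqn -> satisfies A eqn) ->
    forall eqn, Eq K eqn -> satisfies A eqn.

Definition finitely_based (K : set algebra) : Prop :=
  exists2 Sigma : set equation, finite_set Sigma & is_basis Sigma K.

Definition nontrivial (K : set algebra) : Prop :=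
  exists2 A : algebra, K A & exists x y : A, x <> y.

Record idempotent_semiring (A : algebra) : Prop := IdempotentSemiring {
  mul_assoc : associative (@mul A);
  mul_e_left : left_id e (@mul A);
  mul_e_right : right_id e (@mul A);
  join_assoc : associative (@join A);
  join_comm : commutative (@join A);
  join_idem : idempotent_op (@join A);
  mul_join_distr : forall a b c d : A,
    mul (mul a (join b c)) d = join (mul (mul a b) d) (mul (mul a c) d) }.

Definition idempotent_semifield (A : algebra) : Prop :=
  idempotent_semiring A /\
  forall x : A, exists y : A, mul x y = e /\ mul y x = e.

(* Main.v *)
From mathcomp Require Import all_boot all_order all_algebra.
From mathcomp Require Import boolp classical_sets cardinality functions.
From mathcomp Require Import zify.
(* After MathComp, whose algebra files also export names such as [mul]. *)
Require Import Defs.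
Set Implicit Arguments.
Unset Strict Implicit.
Unset Printing Implicit Defensive.

(* The powers of some g > e in a nontrivial member of K form a copy of (Z, max, +),
   so every equation of Eq(K) holds in (Z, max, +). On the other hand, for
   s = x_0 ... x_(k-1), and s_i the word s without x_i, every idempotent semifield
   satisfies s <= s^2 \/ s_0 \/ ... \/ s_(k-1): writing the right-hand side as s h
   and u_i = x_i ... x_(k-1), one gets s <= h and u_(i+1) <= u_i h, hence
   e <= h^(k+1) and so e <= h. It remains to find, for each n and all k > 2^n, an
   algebra satisfying the equations of (Z, max, +) in n variables, but not this one.

   The exponent vectors of s^2 and the s_i are the vertices of a simplex whose only
   other lattice point is its interior point (1, ..., 1), the exponent vector of s.
   Let T be the set of these vertices, X^o = {c | c + X <= T} for sets X of vectors,
   and consider the algebra of nonempty sets X = X^oo. The inequality above fails in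
   it. Suppose that p = q holds in (Z, max, +) and that all sums obtained from p,
   shifted by c, lie in T. No two points of T have their midpoint in T, so a variable
   repeated in a monomial of q ranges over a single vector; thus any sum y obtained
   from q is a value of that monomial for a choice u of one vector for each variable,
   and every linear functional at c + y is bounded by its values at points of T
   obtained from p using u. Hence c + y lies in T or is (1, ..., 1), and the latter
   forces every vertex s_i to be obtained from p using u; the s_i separate
   coordinates, so the k supports {x | u_x(i) > 0} are distinct subsets of n
   variables, contradicting k > 2^n. *)

(** * Order and integer powers in an idempotent semifield *)

Section Semifields.

Context (A : algebra) (semifieldA : idempotent_semifield A).
Implicit Types a b c g h x : A.

Let semiringA : idempotent_semiring A := semifieldA.1.
Let mulxA : associative (@mul A) := mul_assoc semiringA.
Let mule1 : right_id e (@mul A) := mul_e_right semiringA.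
Let mul1e : left_id e (@mul A) := mul_e_left semiringA.
Let joinxA : associative (@join A) := join_assoc semiringA.
Let joinxC : commutative (@join A) := join_comm semiringA.
Let joinxx : idempotent_op (@join A) := join_idem semiringA.

Definition le a b : Prop := join a b = b.

Lemma mul_joinr a b c : mul a (join b c) = join (mul a b) (mul a c).
Proof. by have := mul_join_distr semiringA a b c e; rewrite !mule1. Qed.

Lemma mul_joinl a b c : mul (join b c) a = join (mul b a) (mul c a).
Proof. by have := mul_join_distr semiringA e b c a; rewrite !mul1e. Qed.

Lemma le_refl a : le a a.
Proof. exact: joinxx. Qed.

Lemma le_trans b a c : le a b -> le b c -> le a c.
Proof. by rewrite /le => ab bc; rewrite -bc joinxA ab. Qed.

Lemma le_anti a b : le a b -> le b a -> a = b.
Proof. by rewrite /le => ab; rewrite joinxC ab. Qed.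

Lemma le_joinl a b : le a (join a b).
Proof. by rewrite /le joinxA joinxx. Qed.

Lemma le_joinr a b : le b (join a b).
Proof. by rewrite joinxC; exact: le_joinl. Qed.

Lemma join_lub a b c : le a c -> le b c -> le (join a b) c.
Proof. by rewrite /le -joinxA => ac ->. Qed.

Lemma le_mul2l c a b : le a b -> le (mul c a) (mul c b).
Proof. by rewrite /le -mul_joinr => ->. Qed.

Lemma le_mul2r c a b : le a b -> le (mul a c) (mul b c).
Proof. by rewrite /le -mul_joinl => ->. Qed.

Lemma le_mul2l_cancel c a b : le (mul c a) (mul c b) -> le a b.
Proof.
have [d [_ dc]] := semifieldA.2 c.
by move=> /(le_mul2l d); rewrite !mulxA dc !mul1e.
Qed.

Lemma le_mul2r_cancel c a b : le (mul a c) (mul b c) -> le a b.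
Proof.
have [d [cd _]] := semifieldA.2 c.
by move=> /(le_mul2r d); rewrite -!mulxA cd !mule1.
Qed.

Definition power g n : A := iter n (mul^~ g) e.

Lemma powerS g n : power g n.+1 = mul g (power g n).
Proof. by elim: n => [|n IHn]; rewrite /= ?mul1e ?mule1// mulxA -IHn. Qed.

(* With [v = e \/ h \/ ... \/ h^n] one has [v <= h v], and [v] can be cancelled. *)
Lemma power_ge_e h n : le e (power h n.+1) -> le e h.
Proof.
pose v := fix v j := if j is j.+1 then join e (mul h (v j)) else e.
have power_v j : le (power h j) (v j).
  elim: j => [|j IHj]; first exact: le_refl.
  by rewrite powerS; apply: le_trans (le_joinr _ _); exact: le_mul2l.
have v_incr j : le (v j) (v j.+1).
  elim: j => [|j IHj]; first exact: le_joinl.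
  by apply: join_lub; [exact: le_joinl|apply: le_trans (le_joinr _ _); exact: le_mul2l].
move=> hn; apply: (@le_mul2r_cancel (v n)); rewrite mul1e.
have hv : le e (mul h (v n)).
  by apply: le_trans hn _; rewrite powerS; exact: le_mul2l.
case: n {hn} hv => [//|n] hv.
by apply: join_lub => //; exact: le_mul2l.
Qed.

Definition int_power g g' (z : int) : A :=
  match z with Posz n => power g n | Negz n => power g' n.+1 end.

Section IntPower.

Context (g g' : A) (gg' : mul g g' = e) (g'g : mul g' g = e).

Lemma int_power_succ z : int_power g g' (z + 1)%R = mul (int_power g g' z) g.
Proof.
case: z => n; first by rewrite -[(_ + _)%R]/(Posz (n + 1)) addn1.
rewrite NegzE; case: n => [|n]; first by rewrite /= -mulxA g'g mule1.
have -> : (- n.+2%:Z + 1 = Negz n)%R by rewrite NegzE; lia.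
by rewrite -NegzE /= -mulxA g'g mule1.
Qed.

Lemma int_powerD y z :
  int_power g g' (y + z)%R = mul (int_power g g' y) (int_power g g' z).
Proof.
elim/int_rect: z => [|n IHn|n IHn]; first by rewrite GRing.addr0 /= mule1.
  have -> : (y + n.+1 = (y + n) + 1)%R by lia.
  by rewrite int_power_succ IHn -mulxA.
have cancel_g a b : mul a g = mul b g -> a = b.
  by move=> /(congr1 (mul^~ g')); rewrite -!mulxA gg' !mule1.
apply: cancel_g; rewrite -int_power_succ -mulxA -int_power_succ.
have -> : (y - n.+1%:Z + 1 = y - n%:Z)%R by lia.
by have -> : (- n.+1%:Z + 1 = - n%:Z)%R by lia.
Qed.

Context (le_eg : le e g).

Lemma int_power_mono y z : (y <= z)%R -> le (int_power g g' y) (int_power g g' z).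
Proof.
move=> yz; have -> : (z = y + `|z - y|%N)%R by lia.
elim: `|_|%N => [|n IHn]; first by rewrite GRing.addr0; exact: le_refl.
have -> : (y + n.+1 = (y + n) + 1)%R by lia.
rewrite int_power_succ; apply: (le_trans IHn).
by rewrite -{1}[int_power _ _ _]mule1; exact: le_mul2l.
Qed.

Lemma int_power_max y z :
  int_power g g' (Num.max y z) = join (int_power g g' y) (int_power g g' z).
Proof.
case: (Order.TotalTheory.leP y z) => yz; first by rewrite (int_power_mono yz).
by rewrite joinxC (int_power_mono (Order.POrderTheory.ltW yz)).
Qed.

Context (g_neq_e : g <> e).

(** If g^y = g^z with y < z, then g^(y+1) <= g^z = g^y, and cancelling g^y leaves g <= e. *)
Lemma int_power_inj : injective (int_power g g').
Proof.
have pos (y z : int) : (y < z)%R -> int_power g g' y <> int_power g g' z.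
  move=> yz eq_yz; apply: g_neq_e; apply: le_anti le_eg.
  apply: (@le_mul2l_cancel (int_power g g' y)).
  rewrite mule1 -int_power_succ eq_yz.
  by apply: int_power_mono; lia.
move=> y z eq_yz; case: (Order.TotalTheory.ltgtP y z) => // /pos; by rewrite eq_yz.
Qed.

End IntPower.

(** For x <> y, either x y^-1 is not below e and its join with e works, or its inverse does. *)
Lemma exists_gt_e : (exists x y : A, x <> y) -> exists2 g, le e g & g <> e.
Proof.
move=> [x [y neq_xy]]; have [y' [yy' y'y]] := semifieldA.2 y.
have neq_e : mul x y' <> e.
  move=> /(congr1 (mul^~ y)); rewrite -mulxA y'y mule1 mul1e; exact: neq_xy.
have [z_le|] := pselect (le (mul x y') e); last first.
  by move=> n_le; exists (join (mul x y') e); [exact: le_joinr|exact: n_le].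
have [z' [zz' z'z]] := semifieldA.2 (mul x y').
exists z' => [|z'e]; first by move/(le_mul2l z'): z_le; rewrite z'z mule1.
by apply: neq_e; rewrite -zz' z'e mule1.
Qed.

End Semifields.

(** * Evaluation in (Z, max, +) and expansion into monomials *)

Fixpoint trop_eval (w : nat -> int) (t : term) : int :=
  match t with
  | Var x => w x
  | Join t1 t2 => Num.max (trop_eval w t1) (trop_eval w t2)
  | Mul t1 t2 => (trop_eval w t1 + trop_eval w t2)%R
  | E => 0%R
  end.

Definition trop_equiv p q := forall w, trop_eval w p = trop_eval w q.

Lemma satisfies_trop_equiv (A : algebra) (eqn : equation) :
  idempotent_semifield A -> (exists x y : A, x <> y) -> satisfies A eqn ->
  trop_equiv eqn.1 eqn.2.
Proof.
move=> sfA ntA satA w; have [g le_eg neq_ge] := exists_gt_e sfA ntA.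
have [g' [gg' g'g]] := sfA.2 g.
apply: (int_power_inj sfA g'g le_eg neq_ge).
apply: (satA (fun t => int_power g g' (trop_eval w t))); split => //= x y.
  exact: (int_power_max sfA g'g le_eg).
exact: (int_powerD sfA gg' g'g).
Qed.

Fixpoint monomials (t : term) : seq (seq nat) :=
  match t with
  | Var x => [:: [:: x]]
  | Join t1 t2 => monomials t1 ++ monomials t2
  | Mul t1 t2 => [seq l1 ++ l2 | l1 <- monomials t1, l2 <- monomials t2]
  | E => [:: [::]]
  end.

Lemma trop_eval_ge (w : nat -> int) t l :
  l \in monomials t -> (\sum_(x <- l) w x <= trop_eval w t)%R.
Proof.
elim: t l => [x|t1 IH1 t2 IH2|t1 IH1 t2 IH2|] l /=.
- by rewrite inE => /eqP->; rewrite big_seq1.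
- by rewrite mem_cat Order.TotalTheory.le_max => /orP[/IH1->|/IH2->]; rewrite ?orbT.
- by case/allpairsP => -[l1 l2] /= [/IH1 l1t /IH2 l2t ->]; rewrite big_cat Num.Theory.lerD.
- by rewrite inE => /eqP->; rewrite big_nil.
Qed.

Lemma trop_eval_attained (w : nat -> int) t :
  exists2 l, l \in monomials t & (trop_eval w t = \sum_(x <- l) w x)%R.
Proof.
elim: t => [x|t1 [l1 l1t e1] t2 [l2 l2t e2]|t1 [l1 l1t e1] t2 [l2 l2t e2]|] /=.
- by exists [:: x]; rewrite ?inE ?big_seq1.
- case: (Order.TotalTheory.leP (trop_eval w t1) (trop_eval w t2)) => _.
    by exists l2; rewrite // mem_cat l2t orbT.
  by exists l1; rewrite // mem_cat l1t.
- exists (l1 ++ l2); last by rewrite big_cat e1 e2.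
  exact: allpairs_f.
- by exists [::]; rewrite ?inE ?big_nil.
Qed.

(** The witness is a monomial of [p] attaining the maximum at [w], so it varies with [w]. *)
Lemma trop_equiv_dominated p q l (w : nat -> int) : trop_equiv p q -> l \in monomials q ->
  exists2 l', l' \in monomials p & (\sum_(x <- l) w x <= \sum_(x <- l') w x)%R.
Proof.
move=> pq lq; have [l' l'p e'] := trop_eval_attained w p.
by exists l'; rewrite // -e' pq trop_eval_ge.
Qed.

Fixpoint var_bound (t : term) : nat :=
  match t with
  | Var x => x.+1
  | Join t1 t2 | Mul t1 t2 => maxn (var_bound t1) (var_bound t2)
  | E => 0
  end.

Lemma var_boundP t l x : l \in monomials t -> x \in l -> x < var_bound t.
Proof.
elim: t l => [y|t1 IH1 t2 IH2|t1 IH1 t2 IH2|] l /=.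
- by rewrite inE => /eqP->; rewrite inE => /eqP->.
- by rewrite mem_cat leq_max => /orP[/IH1|/IH2] H /H ->; rewrite ?orbT.
- case/allpairsP => -[l1 l2] /= [/IH1 H1 /IH2 H2 ->].
  by rewrite mem_cat leq_max => /orP[/H1|/H2] ->; rewrite ?orbT.
- by rewrite inE => /eqP->.
Qed.

(** * The deletion inequality and its validity in idempotent semifields *)

Definition word (l : seq nat) : term := foldr (fun x => Mul (Var x)) E l.

Lemma monomials_word l : monomials (word l) = [:: l].
Proof. by elim: l => //= x l ->. Qed.

Definition deletions (l : seq nat) : term :=
  foldr (fun x => Join (word (rem x l))) (Mul (word l) (word l)) l.

(** An inequality a <= b is encoded as a \/ b = b. *)
Definition deletion_equation l : equation :=
  (Join (word l) (deletions l), deletions l).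

Lemma monomials_deletions l :
  monomials (deletions l) = rcons [seq rem x l | x <- l] (l ++ l).
Proof.
(* Only the traversed list is generalised; the list from which letters are deleted stays fixed. *)
rewrite /deletions; move: {4 6}l => s; elim: s => [|x s /= ->].
  by rewrite /= !monomials_word.
by rewrite monomials_word.
Qed.

Lemma semifield_deletion (A : algebra) l :
  idempotent_semifield A -> uniq l -> satisfies A (deletion_equation l).
Proof.
move=> sfA ul f [fJ fM fE]; have srA := sfA.1; rewrite /= fJ -/(le _ _).
have fC l1 l2 : f (word (l1 ++ l2)) = mul (f (word l1)) (f (word l2)).
  elim: l1 => [|x l1 IH]; first by rewrite fE (mul_e_left srA).
  by rewrite -[word _]/(Mul (Var x) (word (l1 ++ l2))) !fM IH (mul_assoc srA).
set s := f (word l); set u := f (deletions l).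
have le_sq : le (mul s s) u.
  rewrite /u /deletions; move: {4}l => s''; elim: s'' => [|x s' IH] /=.
    by rewrite fM; exact: le_refl.
  by rewrite fJ; apply: (le_trans sfA) IH _; exact: le_joinr.
have le_rem x : x \in l -> le (f (word (rem x l))) u.
  rewrite /u /deletions; elim: {1 6}l => [//|y s' IH] /=.
  rewrite inE fJ => /predU1P[->|/IH le_s']; first exact: le_joinl.
  by apply: (le_trans sfA) le_s' _; exact: le_joinr.
have [s' [ss' s's]] := sfA.2 s.
pose h := mul s' u; have sh : mul s h = u.
  by rewrite /h (mul_assoc srA) ss' (mul_e_left srA).
have le_sh : le s h by apply: (le_mul2l_cancel sfA (c := s)); rewrite sh.
(* Here [l2] is a suffix u_i. Multiplied on the left by the prefix [l1], the inequality u_(i+1) <=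
   u_i h becomes s_i <= s h = [u]. *)
have chain l1 l2 : l1 ++ l2 = l -> le e (mul (f (word l2)) (power h (size l2))).
  elim: l2 l1 => [|x l2 IH] l1 def_l.
    by rewrite /= fE (mul_e_left srA); exact: le_refl.
  have := IH (rcons l1 x); rewrite cat_rcons => /(_ def_l) le_e.
  apply: (le_trans sfA) le_e _.
  rewrite [size _]/= (powerS sfA) (mul_assoc srA); apply: le_mul2r => //.
  apply: (le_mul2l_cancel sfA (c := f (word l1))).
  rewrite (mul_assoc srA) -!fC def_l -/s sh.
  (* Distinctness of the letters ensures that [rem] deletes this very occurrence of [x]. *)
  have x_l1 : x \notin l1 by move: ul; rewrite -def_l cat_uniq /= => /and3P[_ /norP[]].
  have -> : l1 ++ l2 = rem x l.
    rewrite -def_l remE index_cat (negPf x_l1) /= eqxx addn0.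
    by rewrite take_size_cat// drop_cat ltnNge leqnSn /= subSnn /= drop0.
  by apply: le_rem; rewrite -def_l mem_cat mem_head orbT.
have le_eh : le e h.
  apply: (power_ge_e sfA (n := size l)).
  apply: (le_trans sfA) (chain [::] l erefl) _.
  by rewrite (powerS sfA); exact: le_mul2r.
by rewrite -sh -{1}[s](mul_e_right srA); exact: le_mul2l.
Qed.

(* The universe of carriers in [algebra] lies below that of [set algebra], hence
   below that of [nmodType]: an abstract commutative monoid would not do here. *)
Local Notation M := (nat -> nat).

(** * The algebra of closed sets for the polarity of [T] *)

Section ClosedSets.


Context (T : set M).
Local Open Scope classical_set_scope.
Implicit Types X Y : set M.

Definition polar X : set M := [set c | forall x, X x -> T (c + x)%R].

Definition set_sum X Y : set M := [set (x + y)%R | x in X & y in Y].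

Lemma polar_setU X Y : polar (X `|` Y) = polar X `&` polar Y.
Proof.
apply/seteqP; split=> c; first by move=> H; split=> x xX; apply: H; [left|right].
by move=> [cX cY] x [/cX|/cY].
Qed.

Lemma polar_set_sum X Y :
  polar (set_sum X Y) = [set c | forall y, Y y -> polar X (c + y)%R].
Proof.
apply/seteqP; split=> c.
  move=> H y Yy x Xx; rewrite -GRing.addrA [(y + x)%R]GRing.addrC.
  by apply: H; exists x => //; exists y.
move=> H _ [x Xx [y Yy <-]].
by rewrite [(x + y)%R]GRing.addrC GRing.addrA; exact: H.
Qed.

Lemma set_sumC X Y : set_sum X Y = set_sum Y X.
Proof.
by apply/seteqP; split=> _ [x Xx [y Yy <-]]; rewrite GRing.addrC; exists y => //; exists x.
Qed.

(** The polar of a sum depends on each summand only through its polar, so closures can be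
    postponed. *)
Lemma polar_set_sum_eq X X' Y Y' : polar X = polar X' -> polar Y = polar Y' ->
  polar (set_sum X Y) = polar (set_sum X' Y').
Proof.
move=> eX eY; rewrite polar_set_sum eX -polar_set_sum.
by rewrite set_sumC polar_set_sum eY -polar_set_sum set_sumC.
Qed.

Lemma sub_bipolar X : X `<=` polar (polar X).
Proof. by move=> x Xx c; rewrite GRing.addrC; apply. Qed.

Lemma polarK X : polar (polar (polar X)) = polar X.
Proof.
apply/seteqP; split; last exact: sub_bipolar.
by move=> c H x Xx; apply: H; exact: sub_bipolar.
Qed.

(** Nonemptiness later allows choosing a vector for every variable. *)
Record closed_set := ClosedSet {
  set_of_closed : M -> Prop;
  closed_neq0 : set_of_closed !=set0;
  closedK : polar (polar set_of_closed) = set_of_closed }.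

Lemma closed_set_inj (X Y : closed_set) :
  polar (set_of_closed X) = polar (set_of_closed Y) -> X = Y.
Proof.
case: X Y => [X X0 XK] [Y Y0 YK] /= e_XY.
have {e_XY} e_XY : X = Y by rewrite -XK e_XY.
by case: _ / e_XY Y0 YK => *; congr ClosedSet; exact: Prop_irrelevance.
Qed.

Lemma bipolar_neq0 X : X !=set0 -> polar (polar X) !=set0.
Proof. by move=> [x Xx]; exists x; exact: sub_bipolar. Qed.

Definition closure X (X0 : X !=set0) : closed_set :=
  ClosedSet (bipolar_neq0 X0) (polarK (polar X)).

Lemma setU_neq0 X Y : X !=set0 -> X `|` Y !=set0.
Proof. by move=> [x Xx]; exists x; left. Qed.

Lemma set_sum_neq0 X Y : X !=set0 -> Y !=set0 -> set_sum X Y !=set0.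
Proof. by move=> [x Xx] [y Yy]; exists (x + y)%R, x => //; exists y. Qed.

Definition closed_algebra : algebra := {|
  carrier := closed_set;
  join C D := closure (setU_neq0 (set_of_closed D) (closed_neq0 C));
  mul C D := closure (set_sum_neq0 (closed_neq0 C) (closed_neq0 D));
  e := closure (ex_intro [set 0%R] 0%R erefl) |}.

(** Each occurrence of a variable picks its vector independently. *)
Fixpoint word_sums (v : nat -> set M) (l : seq nat) : set M :=
  if l is x :: l' then set_sum (v x) (word_sums v l') else [set 0%R].

Definition term_sums v t : set M :=
  [set y | exists2 l, l \in monomials t & word_sums v l y].

Lemma word_sums_cat v l1 l2 :
  word_sums v (l1 ++ l2) = set_sum (word_sums v l1) (word_sums v l2).
Proof.
elim: l1 => [|x l1 IH] /=.
  apply/seteqP; split=> [y Hy|_ [_ -> [y Hy <-]]]; last by rewrite GRing.add0r.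
  by exists 0%R => //; exists y => //; rewrite GRing.add0r.
rewrite IH; apply/seteqP; split=> _ [a Ha [b Hb <-]].
  case: Hb => c Hc [d Hd <-]; exists (a + c)%R; first by exists a => //; exists c.
  by exists d => //; rewrite GRing.addrA.
case: Ha => c Hc [d Hd <-]; exists c => //; exists (d + b)%R; last by rewrite GRing.addrA.
by exists d => //; exists b.
Qed.

Lemma term_sums_Var v x : term_sums v (Var x) = v x.
Proof.
apply/seteqP; split=> y.
  by move=> [l]; rewrite inE => /eqP-> [a va [_ -> <-]]; rewrite GRing.addr0.
move=> vy; exists [:: x]; first by rewrite inE.
by exists y => //; exists 0%R => //; rewrite GRing.addr0.
Qed.

Lemma term_sums_Join v t1 t2 :
  term_sums v (Join t1 t2) = term_sums v t1 `|` term_sums v t2.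
Proof.
apply/seteqP; split=> y.
  by move=> [l]; rewrite mem_cat => /orP[]; [left|right]; exists l.
by move=> [] [l lt ly]; exists l; rewrite // mem_cat lt ?orbT.
Qed.

Lemma term_sums_Mul v t1 t2 :
  term_sums v (Mul t1 t2) = set_sum (term_sums v t1) (term_sums v t2).
Proof.
apply/seteqP; split=> y.
  move=> [_ /allpairsP[[l1 l2] /= [l1t l2t ->]]].
  rewrite word_sums_cat => -[a Ha [b Hb <-]].
  by exists a; [exists l1|exists b => //; exists l2].
move=> [a [l1 l1t Ha] [b [l2 l2t Hb] <-]]; exists (l1 ++ l2); first exact: allpairs_f.
by rewrite word_sums_cat; exists a => //; exists b.
Qed.

Lemma term_sums_E v : term_sums v E = [set 0%R].
Proof.
apply/seteqP; split=> y; first by move=> [l]; rewrite inE => /eqP->.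
by move=> ->; exists [::].
Qed.

(** Only the polars of [v] matter: [v] may consist of the values of [f] or of sets whose closures
    are these values. *)
Lemma polar_hom (f : term_algebra -> closed_algebra) (v : nat -> set M) t :
  homomorphism f -> (forall x, polar (set_of_closed (f (Var x))) = polar (v x)) ->
  polar (set_of_closed (f t)) = polar (term_sums v t).
Proof.
move=> [fJ fM fE] fv.
elim: t => [x|t1 IH1 t2 IH2|t1 IH1 t2 IH2|].
- by rewrite term_sums_Var fv.
- by rewrite fJ term_sums_Join /= polarK !polar_setU IH1 IH2.
- by rewrite fM term_sums_Mul /= polarK; exact: polar_set_sum_eq.
- by rewrite fE term_sums_E /= polarK.
Qed.

Lemma satisfies_closed_algebra p q :
  (forall v, (forall x, v x !=set0) -> polar (term_sums v p) = polar (term_sums v q)) ->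
  satisfies closed_algebra (p, q).
Proof.
move=> pq f homf; apply: closed_set_inj.
have homE t := polar_hom t homf (fun x => erefl).
by rewrite !homE pq// => x; exact: closed_neq0.
Qed.

Fixpoint term_eval (B : algebra) (v : nat -> B) (t : term) : B :=
  match t with
  | Var x => v x
  | Join t1 t2 => join (term_eval v t1) (term_eval v t2)
  | Mul t1 t2 => mul (term_eval v t1) (term_eval v t2)
  | E => e
  end.

Lemma closed_algebra_satisfies p q (v : nat -> set M) :
  (forall x, v x !=set0) -> satisfies closed_algebra (p, q) ->
  polar (term_sums v p) = polar (term_sums v q).
Proof.
move=> v0 sat.
pose f : term_algebra -> closed_algebra :=
  @term_eval closed_algebra (fun x => closure (v0 x)).
have hom : homomorphism f by [].
have homE t := polar_hom t hom (fun x => polarK (v x)).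
by rewrite -!homE (sat _ hom).
Qed.

Lemma sum_word_sums (v : nat -> set M) (c : nat -> M) l :
  (forall x, v x (c x)) -> word_sums v l (\sum_(x <- l) c x)%R.
Proof.
move=> vc; elim: l => [|x l IH]; first by rewrite big_nil.
by rewrite big_cons; exists (c x) => //; exists (\sum_(y <- l) c y)%R.
Qed.

(** A repeated variable has one value to pick and any other can be assigned freely, so one choice
    serves all occurrences. *)
Lemma word_sums_choice (v : nat -> set M) l y : (forall x, v x !=set0) ->
  (forall x, 1 < count_mem x l -> is_subset1 (v x)) -> word_sums v l y ->
  exists2 c : nat -> M, forall x, v x (c x) & y = (\sum_(x <- l) c x)%R.
Proof.
move=> v0; elim: l y => [|x l IH] y v1 /=.
  move=> ->; exists (fun x => sval (cid (v0 x))); last by rewrite big_nil.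
  by move=> x; exact: (svalP (cid (v0 x))).
move=> [u vu [z Hz <-]].
have [c vc ->] := IH z (fun y H => v1 y (leq_trans H (leq_addl _ _))) Hz.
have [xl|xl] := boolP (x \in l).
  exists c => //; rewrite big_cons; congr (_ + _)%R.
  by apply: (v1 x) => //=; rewrite eqxx ltnS -has_count has_pred1.
exists (fun z' => if z' == x then u else c z') => [z'|].
  by case: eqP => // ->.
rewrite big_cons eqxx; congr (_ + _)%R; apply: eq_big_seq => z' z'l.
by case: eqP => // z'x; rewrite -z'x z'l in xl.
Qed.

(** The vectors of the other variables are fixed and collected in [r]; those of [x] stay free. *)
Lemma word_sums_occurrences (v : nat -> set M) x l : (forall x, v x !=set0) ->
  exists r, forall us, size us = count_mem x l -> (forall u, u \in us -> v x u) ->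
    word_sums v l (\sum_(u <- us) u + r)%R.
Proof.
move=> v0; elim: l => [|y l [r IH]].
  by exists 0%R => us /size0nil-> _; rewrite big_nil GRing.addr0.
have [-> /=|yx] := eqVneq y x.
  exists r; rewrite eqxx => -[//|u us] [Hus] vus.
  rewrite big_cons -GRing.addrA; exists u; first by apply: vus; exact: mem_head.
  exists (\sum_(u' <- us) u' + r)%R => //; apply: IH => // u' u'us.
  by apply: vus; rewrite inE u'us orbT.
have [b vb] := v0 y; exists (b + r)%R => us; rewrite /= (negPf yx) => Hus vus.
exists b => //; exists (\sum_(u <- us) u + r)%R; first exact: IH.
by rewrite GRing.addrCA.
Qed.

End ClosedSets.

(** * The simplex and its lattice points *)

Definition ones k : M := fun j => j < k.
Definition twos k : M := fun j => if j < k then 2 else 0.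
Definition ones_but k i : M := fun j => (j < k) && (j != i).

Definition simplex k : set M :=
  [set y | y = twos k \/ exists2 i, i < k & y = ones_but k i].

Lemma simplex_out k y j : simplex k y -> k <= j -> y j = 0.
Proof. by rewrite leqNgt => -[->|[i _ ->]] /negPf; rewrite /twos /ones_but => ->. Qed.

Lemma simplex_le2 k y j : simplex k y -> y j <= 2.
Proof. by move=> [->|[i _ ->]]; rewrite /twos /ones_but; case: (j < k); case: (j == _). Qed.

Lemma simplex_eq0 k y i : simplex k y -> i < k -> y i = 0 -> y = ones_but k i.
Proof.
move=> [->|[j jk ->]] ik; first by rewrite /twos ik.
by rewrite /ones_but ik /=; case: eqP => // ->.
Qed.

Lemma simplex_ones k : 0 < k -> ~ simplex k (ones k).
Proof.
move=> k0 [/(congr1 (@^~ 0))|[i ik /(congr1 (@^~ i))]].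
  by rewrite /ones /twos k0.
by rewrite /ones /ones_but ik eqxx.
Qed.

(** If the midpoint is [ones_but k i], both endpoints vanish at [i] and so are that vertex; if it is
    [twos k], the bound 2 on coordinates forces them to agree. *)
Lemma simplex_midpoint k (r u v : M) : simplex k (r + (u + u))%R ->
  simplex k (r + (u + v))%R -> simplex k (r + (v + v))%R -> u = v.
Proof.
have addE j (a b : M) : (a + b)%R j = a j + b j by [].
move=> uu uv vv; suff e_uv : (r + (u + u) = r + (v + v))%R.
  by apply/funext => j; have := congr1 (@^~ j) e_uv; rewrite !addE; lia.
case: (uv) => [uvE|[i ik uvE]]; last first.
  have := congr1 (@^~ i) uvE; rewrite !addE /ones_but eqxx andbF => ruv.
  have uui : (r + (u + u))%R i = 0 by rewrite !addE; lia.
  have vvi : (r + (v + v))%R i = 0 by rewrite !addE; lia.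
  exact: etrans (simplex_eq0 uu ik uui) (esym (simplex_eq0 vv ik vvi)).
apply/funext => j; rewrite !addE; have [jk|kj] := ltnP j k.
  have := congr1 (@^~ j) uvE; rewrite !addE /twos jk => ruv.
  by have := simplex_le2 j uu; have := simplex_le2 j vv; rewrite !addE; lia.
by have := simplex_out uu kj; have := simplex_out vv kj; rewrite !addE; lia.
Qed.

(** These include the functionals of all facets: the coordinate sum S opposite [twos k], and (k+1)
    y_i - S opposite [ones_but k i]. *)
Definition lin k (a b : int) i (y : M) : int :=
  (a * (y i)%:Z + b * (\sum_(j < k) y j)%N%:Z)%R.

Lemma lin_sum k a b i (c : M) (u : nat -> M) l :
  lin k a b i (c + \sum_(x <- l) u x)%R
  = (lin k a b i c + \sum_(x <- l) lin k a b i (u x))%R.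
Proof.
have linD (y z : M) : lin k a b i (y + z)%R = (lin k a b i y + lin k a b i z)%R.
  have addE j : (y + z)%R j = y j + z j by [].
  rewrite /lin addE; under eq_bigr do rewrite addE.
  by rewrite big_split /= !PoszD !GRing.mulrDr GRing.addrACA.
elim: l c => [|x l IH] c; first by rewrite !big_nil !GRing.addr0.
by rewrite !big_cons [(c + _)%R]GRing.addrA IH linD; exact/esym/GRing.addrA.
Qed.

Lemma sum_ones k : \sum_(j < k) ones k j = k.
Proof.
rewrite (eq_bigr (fun _ => 1)) ?sum1_card ?card_ord// => j _.
by rewrite /ones ltn_ord.
Qed.

Lemma sum_twos k : \sum_(j < k) twos k j = k * 2.
Proof.
rewrite (eq_bigr (fun _ => 2)) ?sum_nat_const ?card_ord// => j _.
by rewrite /twos ltn_ord.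
Qed.

Lemma sum_ones_but k i : i < k -> \sum_(j < k) ones_but k i j = k.-1.
Proof.
move=> ik; rewrite (bigD1 (Ordinal ik)) //= {1}/ones_but eqxx andbF add0n.
have := sum_ones k; rewrite (bigD1 (Ordinal ik)) //= {1}/ones ik add1n.
move=> /(congr1 predn) /= <-.
by apply: eq_bigr => j; rewrite -val_eqE /ones_but /ones /= => ->; rewrite andbT.
Qed.

Lemma eq_of_sum_ge k (y z : M) : (forall j, j < k -> y j <= z j) ->
  \sum_(j < k) z j <= \sum_(j < k) y j -> forall j, j < k -> y j = z j.
Proof.
move=> yz sum_zy j jk; apply/eqP.
have [_ ] := leqif_sum (fun (i : 'I_k) (_ : xpredT i) => leqif_eq (yz i (ltn_ord i))).
have -> : \sum_(i < k) y i == \sum_(i < k) z i.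
  by rewrite eqn_leq sum_zy andbT; apply: leq_sum => i _; exact: yz.
by move=> /esym/forallP/(_ (Ordinal jk)).
Qed.

Lemma simplex_hull k (y : M) : 0 < k ->
  (forall a b i, exists2 t, simplex k t & (lin k a b i y <= lin k a b i t)%R) ->
  simplex k y \/ y = ones k.
Proof.
move=> k0 hull.
have y_out j : k <= j -> y j = 0.
  move=> kj; have [t tT] := hull 1%R 0%R j.
  by rewrite /lin (simplex_out tT kj); lia.
have ext z : (forall j, k <= j -> z j = 0) -> (forall j, j < k -> y j = z j) -> y = z.
  by move=> z_out yz; apply/funext => j; have [/yz//|kj] := ltnP j k; rewrite y_out ?z_out.
set S := \sum_(j < k) y j.
have S_ge : k.-1 <= S.
  have [t tT] := hull 0%R (- 1)%R 0; rewrite /lin -/S.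
  by case: tT => [->|[i ik ->]]; rewrite ?sum_twos ?sum_ones_but; lia.
have facet i : i < k -> k.+1 * y i <= 2 + S.
  move=> ik; have [t tT] := hull k.+1%:Z%R (- 1)%R i; rewrite /lin -/S.
  case: tT => [->|[j jk ->]]; first by rewrite sum_twos /twos ik; lia.
  by rewrite sum_ones_but// /ones_but ik; case: eqP => _; lia.
(* Summing the facet inequalities gives (k+1) S <= k (2 + S). *)
have S_le : S <= k * 2.
  have : \sum_(i < k) k.+1 * y i <= \sum_(i < k) (2 + S).
    by apply: leq_sum => i _; exact: facet.
  by rewrite -big_distrr /= -/S sum_nat_const card_ord; lia.
have y_le2 i : i < k -> y i <= 2 by move=> /facet; nia.
(* A coordinate 2 forces S >= 2k, whence every coordinate is 2. *)
have [[i ik yi]|y_lt2] := pselect (exists2 i, i < k & y i = 2).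
  left; left; apply: ext => [j|]; first by rewrite /twos ltnNge => ->.
  apply: eq_of_sum_ge => [j jk|]; first by rewrite /twos jk; exact: y_le2.
  by rewrite sum_twos -/S; have := facet i ik; rewrite yi; lia.
have y_le1 i : i < k -> y i <= 1.
  move=> ik; have := y_le2 i ik; rewrite leq_eqVlt => /predU1P[yi|//].
  by case: y_lt2; exists i.
(* If y_i = 0, then [y] is below [ones_but k i], and S >= k-1 gives equality. *)
have [[i ik yi]|y_neq0] := pselect (exists2 i, i < k & y i = 0).
  left; right; exists i => //; apply: ext => [j|]; first by rewrite /ones_but ltnNge => ->.
  apply: eq_of_sum_ge => [j jk|]; last by rewrite sum_ones_but.
  rewrite /ones_but jk; case: eqP => [->|_]; first by rewrite yi.
  exact: y_le1.
right; apply: ext => j; first by rewrite /ones ltnNge => ->.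
move=> jk; have := y_le1 j jk; rewrite /ones jk.
by case: (y j) (fun H => y_neq0 (ex_intro2 _ _ j jk H)) => [[]|[|]].
Qed.

(** * Equations in few variables hold in the simplex algebra *)

Lemma sum_indicator (x : nat) l : (\sum_(z <- l) (z == x)%:Z = (count_mem x l)%:Z)%R.
Proof. by elim: l => [|y l IH]; rewrite ?big_nil// big_cons IH /= PoszD. Qed.

Lemma simplex_transfer k n p q (v : nat -> set M) (c : M) :
  2 ^ n < k -> trop_equiv p q -> var_bound p <= n -> (forall x, (v x !=set0)%classic) ->
  (forall y, term_sums v p y -> simplex k (c + y)%R) ->
  forall y, term_sums v q y -> simplex k (c + y)%R.
Proof.
move=> nk pq pn v0 pT y [l lq ly]; have k0 : 0 < k by apply: leq_ltn_trans nk.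
have v1 x : 1 < count_mem x l -> is_subset1 (v x).
  move=> xl u u' vu vu'.
  (* The indicator of [x] as weight gives a monomial of [p] with at least as many occurrences of
     [x]. *)
  have [l' l'p] := trop_equiv_dominated (fun z => (z == x)%:Z%R) pq lq.
  rewrite !sum_indicator => /(leq_trans xl).
  have [r] := word_sums_occurrences x l' v0.
  case: (count_mem x l') => [//|[//|m]] rP _.
  (* Two occurrences of [x] will range over [u] and [u']; the other [m] receive [u]. *)
  pose r' := (c + (r + \sum_(w <- nseq m u) w))%R.
  have in_T w w' : v x w -> v x w' -> simplex k (r' + (w + w'))%R.
    move=> vw vw'; have := rP [:: w, w' & nseq m u].
    rewrite /= size_nseq !big_cons => /(_ erefl) H.
    have -> : (r' + (w + w') = c + (w + (w' + \sum_(j <- nseq m u) j) + r))%R.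
      rewrite /r' -GRing.addrA; congr (_ + _)%R; rewrite [RHS]GRing.addrC -GRing.addrA.
      by congr (_ + _)%R; rewrite GRing.addrC GRing.addrA.
    apply: pT; exists l' => //; apply: H => w''; rewrite !inE.
    by case/or3P => [/eqP->//|/eqP->//|/nseqP[->]].
  by apply: (@simplex_midpoint k r'); exact: in_T.
have [u vu def_y] := word_sums_choice v0 v1 ly.
pose L l' : M := (c + \sum_(x <- l') u x)%R.
have LT l' : l' \in monomials p -> simplex k (L l').
  by move=> l'p; apply: pT; exists l' => //; exact: sum_word_sums.
have hull a b i : exists2 l', l' \in monomials p &
    (lin k a b i (L l) <= lin k a b i (L l'))%R.
  have [l' l'p le_ll'] := trop_equiv_dominated (fun x => lin k a b i (u x)) pq lq.
  by exists l'; rewrite // !lin_sum Num.Theory.lerD2l.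
rewrite def_y -/(L l); case: (@simplex_hull k (L l)) => //.
  by move=> a b i; have [l' /LT] := hull a b i; exists (L l').
move=> L_ones; exfalso.
(* The functional is constant on the facet opposite [ones_but k i]. *)
have hit i : i < k -> exists2 l', l' \in monomials p & L l' = ones_but k i.
  move=> ik; have [l' l'p] := hull (- k.+1%:Z)%R 1%R i.
  rewrite L_ones => le_l'; exists l' => //; move: le_l'.
  case: (LT l' l'p) => [->|[j jk ->]]; rewrite /lin sum_ones /ones ik.
    by rewrite sum_twos /twos ik; lia.
  by rewrite sum_ones_but// /ones_but ik; case: eqP => [<-//|_]; lia.
have LE l' j : L l' j = c j + \sum_(x <- l') u x j by rewrite /L fct_sumE.
pose supp (i : 'I_k) : {set 'I_n} := [set x : 'I_n | 0 < u x i].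
(* If [supp i = supp j], no sum of values of [u] over variables below [n] vanishes
   at [i] but not at [j], whereas [ones_but k i] does. *)
have supp_inj : injective supp.
  move=> i j eq_ij; apply/val_inj/eqP; apply/negPn/negP => neq_ij.
  have [l1 l1p L1] := hit i (ltn_ord i); have [l2 l2p L2] := hit j (ltn_ord j).
  have := congr1 (@^~ (i : nat)) L1; have := congr1 (@^~ (j : nat)) L1.
  have := congr1 (@^~ (j : nat)) L2.
  rewrite !LE /ones_but !eqxx !andbF !ltn_ord (eq_sym (j : nat)) neq_ij /=.
  move=> /eqP; rewrite addn_eq0 => /andP[/eqP-> _]; rewrite add0n => sum_j.
  move=> /eqP; rewrite addn_eq0 => /andP[_]; rewrite sum_nat_seq_eq0 => /allP ui0.
  move: sum_j; rewrite big1_seq// => x /= xl1.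
  have xn : x < n := leq_trans (var_boundP l1p xl1) pn.
  have /setP/(_ (Ordinal xn)) := eq_ij; rewrite !inE /= (eqP (ui0 x xl1)).
  by case: (u x j).
have := leq_card supp supp_inj.
by rewrite card_ord -cardsT -powersetT card_powerset cardsT card_ord; lia.
Qed.

Lemma simplex_algebra_satisfies k n p q :
  2 ^ n < k -> trop_equiv p q -> maxn (var_bound p) (var_bound q) <= n ->
  satisfies (closed_algebra (simplex k)) (p, q).
Proof.
move=> nk pq; rewrite geq_max => /andP[pn qn].
apply: satisfies_closed_algebra => v v0; apply/seteqP; split=> c.
  exact: simplex_transfer nk pq pn v0.
by apply: simplex_transfer nk _ qn v0 => w; rewrite pq.
Qed.

(** With unit vectors for variables, words evaluate to exponent vectors: 0 lies in the polar of the
    right-hand side but, as [ones k] is not a vertex, not in that of the left. *)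
Lemma simplex_algebra_refutes k : 0 < k ->
  ~ satisfies (closed_algebra (simplex k)) (deletion_equation (iota 0 k)).
Proof.
move=> k0 sat.
pose d (x j : nat) : nat := j == x.
pose v x : set M := [set d x]%classic.
have v0 x : (v x !=set0)%classic by exists (d x).
have sumE l y : word_sums v l y -> forall j, y j = count_mem j l.
  elim: l y => [|x l IH] y /=; first by move=> ->.
  by move=> [_ -> [z lz <-]] j; rewrite -(IH z lz) /d eq_sym.
have count_iota j : count_mem j (iota 0 k) = (j < k).
  by rewrite count_uniq_mem ?iota_uniq// mem_iota.
have del0 : polar (simplex k) (term_sums v (deletions (iota 0 k))) 0%R.
  move=> y [l]; rewrite GRing.add0r monomials_deletions mem_rcons inE.
  case/predU1P => [-> /sumE ly|/mapP[i]].
    left; apply/funext => j; rewrite ly count_cat count_iota /twos.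
    by case: ltnP.
  rewrite mem_iota /= add0n => ik -> /sumE ly.
  right; exists i => //; apply/funext => j.
  by rewrite ly count_rem count_iota mem_iota ik /= /ones_but; do ?case: eqP; lia.
move: del0; rewrite -(closed_algebra_satisfies v0 sat) term_sums_Join polar_setU.
move=> [/(_ (ones k)) + _]; rewrite GRing.add0r => one_T.
apply: (simplex_ones k0); apply: one_T; exists (iota 0 k).
  by rewrite monomials_word inE.
have -> : ones k = (\sum_(x <- iota 0 k) d x)%R; last exact: sum_word_sums.
apply/funext => j; rewrite fct_sumE /ones -count_iota.
by elim: (iota 0 k) => [|x l IH]; rewrite ?big_nil// big_cons -IH /d /= eq_sym.
Qed.

(** * Refuting a finite basis *)

Lemma finite_var_bound (Sigma : set equation) : finite_set Sigma ->
  exists n, forall p q, Sigma (p, q) -> maxn (var_bound p) (var_bound q) <= n.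
Proof.
move=> /(finite_image (fun eqn => maxn (var_bound eqn.1) (var_bound eqn.2))).
move=> /finite_seqP[s sE]; exists (\max_(m <- s) m) => p q pq.
have : [set` s]%classic (maxn (var_bound p) (var_bound q)) by rewrite -sE; exists (p, q).
by move=> ms; exact: (@leq_bigmax_seq _ s xpredT id).
Qed.

Theorem theorem1 (K : set algebra)
    (K_semifields : forall A : algebra, K A -> idempotent_semifield A)
    (K_nontrivial : nontrivial K) :
  ~ finitely_based K.
Proof.
move=> [Sigma /finite_var_bound[n nP] [SigmaK basis]].
have [A KA ntA] := K_nontrivial.
(* This length exceeds the number of subsets of the [n] variables available to [Sigma]. *)
apply: (@simplex_algebra_refutes (2 ^ n).+1 isT).
apply: basis => [[p q] pq|B KB]; last first.
  by apply: semifield_deletion; [exact: K_semifields|exact: iota_uniq].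
apply: (simplex_algebra_satisfies (leqnn _)); last exact: nP.
exact: satisfies_trop_equiv (K_semifields A KA) ntA (SigmaK _ pq A KA).
Qed.
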